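(* Let $(Y_m)_{m\ge1}$ be independent discrete random variables on $[0,1)$, not necessarily identically distributed, with densities $$g_m(x)=\sum_{k=1}^{r_m} w_{k,m}\,\delta_{\alpha_{k,m}}(x),\qquad w_{k,m}>0,\qquad \sum_{k=1}^{r_m} w_{k,m}=1$$ (i.e. $Y_m$ has law $\sum_{k=1}^{r_m} w_{k,m}\delta_{\alpha_{k,m}}$). Assume that there is a finite set $A\subset[0,1)$ such that $\alpha_{k,m}\in A$ for all $m\ge1$ and $1\le k\le r_m$. Then the sum $Y_1+\cdots+Y_M$ modulo $1$ converges weakly to the uniform distribution on $[0,1)$ as $M\to\infty$ if and only if for each integer $n\neq 0$ we have $$\lim_{M\to\infty}\widehat{g_1}(n)\,\widehat{g_2}(n)\cdots\widehat{g_M}(n)=0.$$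
   Context: $\delta_\alpha$ denotes a unit point mass at $\alpha$. The Fourier coefficients of $g_m$ are $\widehat{g_m}(n)=\int_0^1 g_m(x)e^{-2\pi i n x}\,dx=\sum_{k=1}^{r_m} w_{k,m}e^{-2\pi i n\alpha_{k,m}}$ for $n\in\mathbb{Z}$. Weak convergence to the uniform distribution means $\mathbb{E}[\phi(Y_1+\cdots+Y_M \bmod 1)]\to\int_0^1\phi(x)\,dx$ for every continuous $1$-periodic test function $\phi:\mathbb{R}\to\mathbb{C}$, i.e. weak convergence of probability measures on the circle $\mathbb{R}/\mathbb{Z}$. *)

(* Defs.v *)
From HB Require Import structures.
From mathcomp Require Import all_boot all_order all_algebra finmap.
From mathcomp Require Import all_classical all_reals all_analysis measurable_realfun.
From mathcomp Require Import complex.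

Set Implicit Arguments.
Unset Strict Implicit.
Unset Printing Implicit Defensive.

Import Order.TTheory GRing.Theory Num.Theory.
Import numFieldNormedType.Exports.

Local Open Scope classical_set_scope.
Local Open Scope ring_scope.

(* The integral of a complex-valued function is taken componentwise. [R[i]^o]
   is R[i] with its topology as a normed field. *)
Definition Cintegral d (T : measurableType d) (R : realType)
    (mu : {measure set T -> \bar R}) (D : set T) (f : T -> R[i]^o) : R[i]^o :=
  ((\int[mu]_(x in D) complex.Re (f x))
     +i* (\int[mu]_(x in D) complex.Im (f x)))%C.

Definition expi (R : realType) (theta : R) : R[i]^o :=
  (cos theta +i* sin theta)%C.

Definition frac_part (R : realType) (x : R) : R := x - (Num.floor x)%:~R.

(* \sum_k w_k \delta_(a_k); the points a_k need not be distinct. *)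
Definition atomic (R : realType) (r : nat) (w : 'I_r -> {posnum R})
    (a : 'I_r -> R) (B : set R) : \bar R :=
  (\sum_(k < r) (w k)%:num%:E * \d_(a k) B)%E.

Lemma atomic_msum (R : realType) (r : nat) (w : 'I_r -> {posnum R})
    (a : 'I_r -> R) :
  atomic w a = msum (fun k => if insub k is Some i
                              then mscale (w i)%:num%:nng \d_(a i)
                              else (mzero : {measure set R -> \bar R})) r.
Proof.
by apply/funext => B; rewrite /msum; apply: eq_bigr => k _; rewrite valK.
Qed.

Lemma atomic0 (R : realType) (r : nat) (w : 'I_r -> {posnum R})
  (a : 'I_r -> R) : atomic w a set0 = 0%E.
Proof. by rewrite atomic_msum measure0. Qed.

Lemma atomic_ge0 (R : realType) (r : nat) (w : 'I_r -> {posnum R})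
  (a : 'I_r -> R) (B : set R) : (0 <= atomic w a B)%E.
Proof. by rewrite atomic_msum. Qed.

Lemma atomic_sigma_additive (R : realType) (r : nat) (w : 'I_r -> {posnum R})
  (a : 'I_r -> R) : semi_sigma_additive (atomic w a).
Proof. by rewrite atomic_msum; exact: measure_semi_sigma_additive. Qed.

HB.instance Definition _ (R : realType) (r : nat) (w : 'I_r -> {posnum R})
    (a : 'I_r -> R) :=
  isMeasure.Build _ R R (atomic w a)
    (atomic0 w a) (@atomic_ge0 R r w a) (@atomic_sigma_additive R r w a).

(* The interval is half-open so that an atom at 0 is counted and an atom at 1,
   the same point of the circle, is not. *)
Definition fourier_coef (R : realType)
    (mu : {measure set R -> \bar R}) (n : int) : R[i]^o :=
  Cintegral mu `[0, 1[ (fun x => expi (- (2 * pi * n%:~R * x))).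

Definition mutually_independent d (Omega : measurableType d) (R : realType)
    (P : probability Omega R) (Y : nat -> {RV P >-> R}) : Prop :=
  forall (J : {fset nat}) (B : nat -> set R),
    (forall m, m \in J -> measurable (B m)) ->
    P (\bigcap_(m in [set` J]) (Y m @^-1` B m)) =
    (\prod_(m <- J) P (Y m @^-1` B m))%E.

Definition cvg_weakly_to_uniform d (Omega : measurableType d) (R : realType)
    (P : probability Omega R) (X : nat -> Omega -> R) : Prop :=
  forall phi : R -> R[i]^o, continuous phi -> periodic phi 1 ->
    (fun M : nat => Cintegral P setT (phi \o X M)) @ \oo -->
    Cintegral (@lebesgue_measure R) `[0, 1] phi.

Lemma ge0_integral_atomic (R : realType) (r : nat) (w : 'I_r -> {posnum R})
    (a : 'I_r -> R) (D : set R) (f : R -> \bar R) :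
  measurable D -> (forall x, D x -> (0 <= f x)%E) -> measurable_fun D f ->
  (\int[atomic w a]_(x in D) f x
   = \sum_(k < r) (w k)%:num%:E * (\d_(a k) D * f (a k)))%E.
Proof.
move=> mD f0 mf; rewrite atomic_msum ge0_integral_measure_sum//; apply: eq_bigr => k _.
by rewrite valK ge0_integral_mscale// integral_dirac.
Qed.

Lemma Rintegral_atomic (R : realType) (r : nat) (w : 'I_r -> {posnum R})
    (a : 'I_r -> R) (D : set R) (f : R -> R) :
  measurable D -> (forall k, D (a k)) -> measurable_fun D f ->
  \int[atomic w a]_(x in D) f x = \sum_(k < r) (w k)%:num * f (a k).
Proof.
move=> mD Da mf; rewrite /Rintegral integralE.
have mf' : measurable_fun D (EFin \o f) by exact/measurable_EFinP.
rewrite !ge0_integral_atomic//; first last.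
- exact: measurable_funepos.
- exact: measurable_funeneg.
have dD k : (\d_(a k) D = 1 :> \bar R)%E by rewrite diracE mem_set.
under eq_bigr do rewrite dD mul1e funeposE /= -EFin_max -EFinM.
under [X in (_ - X)%E]eq_bigr do rewrite dD mul1e funenegE /= -EFin_max -EFinM.
rewrite !sumEFin /= -sumrB; apply: eq_bigr => k _; rewrite -mulrBr.
congr (_ * _); case: (lerP 0 (f (a k))) => f0.
  by rewrite [X in _ - X]max_r ?oppr_le0// subr0.
by rewrite max_l ?oppr_ge0 ?ltW// opprK add0r.
Qed.

Lemma fourier_coef_atomic (R : realType) (r : nat) (w : 'I_r -> {posnum R})
    (a : 'I_r -> R) (n : int) :
  (forall k, a k \in `[0, 1[) ->
  fourier_coef (atomic w a) n =
  \sum_(k < r) ((w k)%:num)%:C%C * expi (- (2 * pi * n%:~R * a k)).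
Proof.
move=> a01; have ml : measurable_fun (`[0, 1[%classic : set R)
    (fun x : R => - (2 * pi * n%:~R * x)).
  by apply: measurableT_comp => //; exact: measurable_funM.
rewrite /fourier_coef /Cintegral /expi /= !Rintegral_atomic//; first last.
- by apply: measurableT_comp ml; exact: continuous_measurable_fun (@continuous_cos R).
- by apply: measurableT_comp ml; exact: continuous_measurable_fun (@continuous_sin R).
apply/eqP; rewrite eq_complex !raddf_sum /=; apply/andP; split; apply/eqP;
  by apply: eq_bigr => k _; rewrite mul0r ?subr0 ?addr0.
Qed.

(* Main.v *)
Require Import Defs.
From HB Require Import structures.
From mathcomp Require Import all_boot all_order all_algebra finmap.
From mathcomp Require Import all_classical all_reals all_analysis measurable_realfun.
From mathcomp Require Import complex zify ring lra.

Set Implicit Arguments.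
Unset Strict Implicit.
Unset Printing Implicit Defensive.

Import Order.TTheory GRing.Theory Num.Theory.
Import numFieldNormedType.Exports.

Local Open Scope classical_set_scope.
Local Open Scope ring_scope.

(* Weyl's criterion on the circle. By independence the product of the Fourier
   coefficients is the n-th Fourier coefficient of Y_1 + ... + Y_M: almost surely
   the vector (Y_1, ..., Y_M) takes finitely many values, and the product of sums
   expands as a sum over these values. Testing weak convergence on the characters
   gives one direction. For the other, a continuous periodic function is uniformly
   within e of a trigonometric polynomial, namely a discrete average of Fejer
   kernels; a Korovkin argument controls the error. *)

(** * Trigonometric sums and the Fejer kernel *)

Section trigonometric_kernel.
Context {R : realType}.
Implicit Types (t u x y : R) (n N : nat).

(* Real and imaginary parts of [(1 - e^(it)) * sum_(k < N) e^(ikt) = 1 - e^(iNt)]. *)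
Lemma trig_sums_telescope t N :
  (\sum_(k < N) cos (k%:R * t)) * (1 - cos t) +
    (\sum_(k < N) sin (k%:R * t)) * sin t = 1 - cos (N%:R * t) /\
  (\sum_(k < N) sin (k%:R * t)) * (1 - cos t) -
    (\sum_(k < N) cos (k%:R * t)) * sin t = - sin (N%:R * t).
Proof.
elim: N => [|N [IHc IHs]]; first by rewrite !big_ord0 !mul0r cos0 sin0; split; ring.
rewrite !big_ord_recr /= -natr1 [(N%:R + 1) * t]mulrDl mul1r cosD sinD.
by split; lra.
Qed.

(** Squared moduli in the telescoped identity: [|1 - e^(it)|^2 = 2 (1 - cos t)], likewise for [N t],
    and the factor 2 cancels. *)
Lemma trig_sums_sqr t N :
  ((\sum_(k < N) cos (k%:R * t)) ^+ 2 + (\sum_(k < N) sin (k%:R * t)) ^+ 2) *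
    (1 - cos t) = 1 - cos (N%:R * t).
Proof.
have [] := trig_sums_telescope t N.
set A := \sum_(k < N) cos _; set B := \sum_(k < N) sin _ => E1 E2.
have := cos2Dsin2 t; have := cos2Dsin2 (N%:R * t).
move: E1 E2; move: (cos t) (sin t) (cos (N%:R * t)) (sin (N%:R * t)) => c s cN sN E1 E2 H1 H2.
have : (A * (1 - c) + B * s) ^+ 2 + (B * (1 - c) - A * s) ^+ 2 =
  (1 - cN) ^+ 2 + sN ^+ 2 by rewrite E1 E2; ring.
have -> : (A * (1 - c) + B * s) ^+ 2 + (B * (1 - c) - A * s) ^+ 2 =
  (A ^+ 2 + B ^+ 2) * (1 - 2 * c + (c ^+ 2 + s ^+ 2)) by ring.
rewrite H2.
have -> : (1 - cN) ^+ 2 + sN ^+ 2 = 1 - 2 * cN + (cN ^+ 2 + sN ^+ 2) by ring.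
rewrite H1; lra.
Qed.

Lemma cos_lt1 t : 0 < t < pi *+ 2 -> cos t < 1.
Proof.
move=> /andP[t0 t2pi]; have -> : t = (t / 2) *+ 2 by rewrite mulr2n; lra.
have : 0 < sin (t / 2).
  by apply: sin_gt0_pi; rewrite divr_gt0//= ltr_pdivrMr// mulr_natr.
by rewrite cos_mulr2n cos2sin2 => s0; have := exprn_gt0 2 s0; rewrite mulr2n; lra.
Qed.

Lemma cosD2pin t (n : int) : cos (t + 2 * pi * n%:~R) = cos t.
Proof.
have H u k : cos (u + 2 * pi * k%:R) = cos u :> R.
  by rewrite mulr_natr mulr_natl (periodicn (@cosD2pi R)).
case: n => k; first exact: H.
by rewrite NegzE mulrNz mulrN -pmulrn -(H (t - _) k.+1) subrK.
Qed.

Lemma sinD2pin t (n : int) : sin (t + 2 * pi * n%:~R) = sin t.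
Proof. by rewrite -!cosBpihalf addrAC cosD2pin. Qed.

(** For [t = 2 pi m / N] the right-hand side of [trig_sums_sqr] is 0, while [cos t < 1] because [N]
    does not divide [m]; so the cosine and sine sums over roots of unity both vanish, and the phase
    [u] splits off. *)
Lemma sum_cos_root u (m : int) N : (0 < `|m| < N)%N ->
  \sum_(j < N) cos (u - 2 * pi * m%:~R * (j%:R / N%:R)) = 0.
Proof.
move=> /andP[m0 mN]; have N0 : N%:R != 0 :> R by rewrite pnatr_eq0; lia.
pose t : R := 2 * pi * m%:~R / N%:R.
have ct : cos t < 1.
  have N_gt0 : 0 < N%:R :> R by rewrite ltr0n; lia.
  have -> : cos t = cos (2 * pi * (`|m|%N%:R / N%:R)).
    rewrite -cos_norm !normrM normfV -intr_norm -abszE (ger0_norm (pi_ge0 R)).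
    by rewrite !ger0_norm// mulrA.
  apply: cos_lt1; apply/andP; split.
    by rewrite !mulr_gt0 ?invr_gt0 ?pi_gt0 ?ltr0n//; lia.
  have -> : pi *+ 2 = 2 * pi * 1 :> R by ring.
  rewrite ltr_pM2l ?mulr_gt0 ?pi_gt0//.
  by rewrite ltr_pdivrMr// mul1r ltr_nat; lia.
have [A0 B0] : \sum_(k < N) cos (k%:R * t) = 0 /\ \sum_(k < N) sin (k%:R * t) = 0.
  have := trig_sums_sqr t N.
  have -> : N%:R * t = 0 + 2 * pi * m%:~R by rewrite /t; field.
  rewrite cosD2pin cos0 subrr => /eqP; rewrite mulf_eq0.
  rewrite [X in _ || X]subr_eq0 (gt_eqF ct) orbF.
  by rewrite paddr_eq0 ?sqr_ge0// !sqrf_eq0 => /andP[/eqP-> /eqP->].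
under eq_bigr => j _.
  rewrite cosB (_ : _ * (_ / _) = j%:R * t); last by rewrite /t; field.
  over.
by rewrite big_split -!mulr_sumr /= A0 B0 !mulr0 addr0.
Qed.

(* The Fejer kernel divided by N, so that its N equispaced samples sum to 1
   ([sum_fejer]): the approximant is then a finite sum and needs no integral. *)
Definition fejer N y : R := N%:R ^- 2 *
  \sum_(k < N) \sum_(l < N) cos (2 * pi * (k%:Z - l%:Z)%:~R * y).

(** The double sum is the squared modulus of [sum_(k < N) e^(2 pi i k y)], whence positivity and the
    use of [trig_sums_sqr]. *)
Lemma fejerE N y : fejer N y = N%:R ^- 2 *
  ((\sum_(k < N) cos (k%:R * (2 * pi * y))) ^+ 2 +
   (\sum_(k < N) sin (k%:R * (2 * pi * y))) ^+ 2).
Proof.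
rewrite /fejer; congr (_ * _); rewrite !expr2 !big_distrl -big_split /=.
apply: eq_bigr => k _; rewrite !big_distrr -big_split /=; apply: eq_bigr => l _.
by rewrite -cosB rmorphB /=; congr cos; ring.
Qed.

Lemma fejer_ge0 N y : 0 <= fejer N y.
Proof. by rewrite fejerE mulr_ge0 ?invr_ge0 ?exprn_ge0 ?addr_ge0 ?sqr_ge0. Qed.

Lemma fejer_decay N y : fejer N y * (1 - cos (2 * pi * y)) <= 2 / N%:R ^+ 2.
Proof.
rewrite fejerE -[leLHS]mulrA trig_sums_sqr mulrC ler_wpM2r ?invr_ge0 ?exprn_ge0//.
by have := cos_geN1 (N%:R * (2 * pi * y)); lra.
Qed.

Lemma sum_fejer N x : (0 < N)%N -> \sum_(j < N) fejer N (x - j%:R / N%:R) = 1.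
Proof.
move=> N0; have NR : N%:R != 0 :> R by rewrite pnatr_eq0; lia.
rewrite -mulr_sumr exchange_big /=.
under eq_bigr => k _.
  (* Off the diagonal [0 < |k - l| < N] and [sum_cos_root] applies; each diagonal term contributes
     [N]. *)
  rewrite exchange_big (bigD1 k) //= [X in _ + X]big1 => [|l lk].
    rewrite subrr mulr0 addr0; under eq_bigr do rewrite mul0r cos0; over.
  under eq_bigr do rewrite mulrBr.
  by apply: sum_cos_root; move: lk (ltn_ord k) (ltn_ord l); rewrite -val_eqE /=; lia.
by rewrite !sumr_const card_ord -mulr_natl; field.
Qed.

End trigonometric_kernel.

Lemma periodic1_int {R : realType} (V : zmodType) (f : R -> V) (x : R) (n : int) :
  periodic f 1 -> f (x + n%:~R) = f x.
Proof.
move=> fp.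
case: n => k; first by rewrite -pmulrn periodicn.
by rewrite NegzE mulrNz -pmulrn -(periodicn fp k.+1) subrK.
Qed.

(** * Uniform approximation of continuous periodic functions *)

Section korovkin.
Context {R : realType} (f : R -> R).
Hypotheses (fc : continuous f) (fp : periodic f 1).

Lemma periodic_bounded : exists2 B, 0 <= B & forall x, `|f x| <= B.
Proof.
have : bounded_set (f @` `[0, 1]).
  apply: compact_bounded; apply: continuous_compact; last exact: segment_compact.
  exact: continuous_subspaceT.
move=> [B [_ /(_ (`|B| + 1))]] H.
exists (`|B| + 1); first by rewrite addr_ge0.
move=> x; rewrite -(periodic1_int x (- Num.floor x) fp); apply: H.
  by rewrite (le_lt_trans (ler_norm _))// ltrDl.
exists (x + (- Num.floor x)%:~R) => //=; rewrite in_itv/=.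
rewrite rmorphN /= subr_ge0 floor_le lerBlDl ltW//=.
by have := floorD1_gt x; rewrite intrD.
Qed.

(** Compactness of [0, 1] makes the neighbourhood of [h = 0] uniform in [x]; periodicity brings
    every [x] into [0, 1]. *)
Lemma periodic_unif_continuous (e : R) : 0 < e ->
  exists2 d, 0 < d & forall x h, `|h| < d -> `|f (x + h) - f x| < e.
Proof.
move=> e0.
have : \forall h \near (0 : R), `[0, 1]%classic `<=` (fun x => `|f (x + h) - f x| < e).
  have /compact_near_coveringP near_cov := @segment_compact R 0 1.
  apply: (near_cov _ (nbhs (0 : R)) (fun h x => `|f (x + h) - f x| < e)) => x _.
  have cfD : (fun p : R * R => f (p.1 + p.2)) @ (x, 0) --> f (x + 0).
    apply: (@cvg_comp _ _ _ (fun p : R * R => p.1 + p.2)); last exact: fc.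
    by apply: cvgD; [exact: cvg_fst|exact: cvg_snd].
  have cf1 : (fun p : R * R => f p.1) @ (x, 0) --> f x.
    by apply: (@cvg_comp _ _ _ fst); [exact: cvg_fst|exact: fc].
  have := cvgB cfD cf1; rewrite addr0 subrr => fB.
  exact: (@cvgr0_norm_lt _ _ _ _ _ _ (fB _) _ e0).
move=> /nbhs_ballP[d /= d0 H]; exists d => // x h hd.
have hb : ball 0 d h by rewrite /ball /= sub0r normrN.
have := H h hb (x + (- Num.floor x)%:~R).
rewrite /= (addrAC x) !periodic1_int//; apply.
rewrite in_itv/= rmorphN /= subr_ge0 floor_le lerBlDl ltW//=.
by have := floorD1_gt x; rewrite intrD.
Qed.

(* [1 - cos] serves as the modulus of continuity because [fejer_decay] makes its
   average against the kernel O(1/N). *)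
Lemma periodic_korovkin_modulus (e : R) : 0 < e ->
  exists2 C, 0 <= C &
    forall x y, `|f x - f y| <= e + C * (1 - cos (2 * pi * (x - y))).
Proof.
move=> e0; have [d d0 Hd] := periodic_unif_continuous e0.
have [B B0 HB] := periodic_bounded.
(* With [d' <= 1/2] the angle [2 pi d'] stays in [0, pi], where cosine decreases. *)
pose d' : R := Num.min d 2^-1; have d'0 : 0 < d' by rewrite lt_min d0 /= invr_gt0 ltr0n.
have d'1 : d' <= 2^-1 by rewrite ge_min lexx orbT.
have pi0 := pi_gt0 R.
have c0 : 0 < 1 - cos (2 * pi * d').
  rewrite subr_gt0 cos_lt1// !mulr_gt0 ?ltr0n//=.
  have -> : pi *+ 2 = pi * 2 :> R by ring.
  have -> : 2 * pi * d' = pi * (2 * d') by ring.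
  by rewrite ltr_pM2l//; lra.
(* This constant makes the cosine term at least the trivial bound [2 B] once [d' <= |h| <= 1/2]; for
   [|h| < d'] uniform continuity suffices. *)
exists (2 * B / (1 - cos (2 * pi * d'))); first by rewrite mulr_ge0 ?invr_ge0 ?(ltW c0)// mulr_ge0.
(* [n] is an integer nearest to [x - y], so [|h|] is the distance from [x] to [y] on the circle. *)
move=> x y; pose n := Num.floor (x - y + 2^-1); pose h := x - y - n%:~R.
have xE : x = y + h + n%:~R by rewrite /h; ring.
have /andP[hl hu] : - 2^-1 <= h < 2^-1.
  have /andP[] := floor_itv (x - y + 2^-1); rewrite -/n intrD /h; lra.
have -> : cos (2 * pi * (x - y)) = cos (2 * pi * `|h|).
  rewrite -[RHS]cos_norm !normrM normr_id -!normrM cos_norm.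
  by rewrite -[RHS](cosD2pin _ n) /h; congr cos; ring.
rewrite xE periodic1_int//; have [hd|hd] := ltP `|h| d'.
  apply: ler_wpDr; last by apply/ltW/Hd/(lt_le_trans hd); rewrite ge_min lexx.
  by rewrite mulr_ge0 ?subr_ge0 ?cos_le1// mulr_ge0 ?invr_ge0 ?(ltW c0)// mulr_ge0.
apply: (@le_trans _ _ (2 * B)).
  by rewrite (le_trans (ler_normB _ _))// mulr_natl mulr2n lerD.
apply: ler_wpDl; first exact: ltW.
rewrite -mulrA ler_peMr ?mulr_ge0// mulrC ler_pdivlMr// mul1r lerB//.
have [->//|hne] := eqVneq d' `|h|.
have h2 : `|h| <= 2^-1 by rewrite ler_norml hl ltW.
have dom (z : R) : 0 <= z -> z <= 2^-1 -> 2 * pi * z \in `[0, pi].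
  move=> z0 z1; rewrite in_itv/= !mulr_ge0 ?(ltW pi0)//=.
  have -> : 2 * pi * z = pi * (2 * z) by ring.
  by rewrite ler_piMr ?(ltW pi0)//; lra.
apply/ltW; rewrite ltr_cos ?dom ?(ltW d'0)//.
by rewrite ltr_pM2l ?mulr_gt0// lt_neqAle hne.
Qed.

(** The kernel samples are nonnegative and sum to 1, so the error is an average of
    [f x - f (j / N)], which the modulus bounds by [e / 2] plus a term that [fejer_decay]
    controls. *)
Lemma fejer_approx (e : R) : 0 < e ->
  exists2 N, (0 < N)%N & forall x,
    `|f x - \sum_(j < N) f (j%:R / N%:R) * fejer N (x - j%:R / N%:R)| <= e.
Proof.
move=> e0; have e20 : 0 < e / 2 by rewrite divr_gt0.
have [C C0 HC] := periodic_korovkin_modulus e20.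
(* [4 C / e < N] makes the total kernel error [N * C * 2 / N^2 = 2 C / N] at most [e / 2]. *)
pose N := (Num.truncn (4 * C / e)).+1; have NR0 : 0 < N%:R :> R by rewrite ltr0n.
exists N => // x.
have -> : f x = \sum_(j < N) f x * fejer N (x - j%:R / N%:R).
  by rewrite -mulr_sumr sum_fejer// mulr1.
rewrite -sumrB.
apply: le_trans (ler_norm_sum _ _ _) _.
apply: (@le_trans _ _
    (\sum_(j < N) (e / 2 * fejer N (x - j%:R / N%:R) + C * (2 / N%:R ^+ 2)))).
  apply: ler_sum => j _; rewrite -mulrBl normrM (ger0_norm (fejer_ge0 _ _)).
  apply: le_trans (ler_wpM2r (fejer_ge0 _ _) (HC _ _)) _.
  rewrite mulrDl lerD2l -[leLHS]mulrA ler_wpM2l//.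
  by rewrite mulrC fejer_decay.
rewrite big_split /= -mulr_sumr sum_fejer// mulr1 sumr_const card_ord.
have : 4 * C / e < N%:R by rewrite truncnS_gt.
rewrite ltr_pdivrMr// => HN.
have -> : C * (2 / N%:R ^+ 2) *+ N = 2 * C / N%:R.
  by rewrite -mulr_natl; field; rewrite lt0r_neq0.
have : 2 * C / N%:R <= e / 2 by rewrite ler_pdivrMr//; lra.
lra.
Qed.

End korovkin.

(** * Weyl's criterion for abstract means *)

Section weyl_criterion.
Context {R : realType}.
Implicit Types (f g : R -> R) (L : (R -> R) -> R).

(** Continuous functions on the circle R/Z, lifted to the line. *)
Definition circle_fun f := continuous f /\ periodic f 1.

Lemma circle_funD f g :
  circle_fun f -> circle_fun g -> circle_fun (fun x => f x + g x).
Proof.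
move=> [cf pf] [cg pg]; split => x; last by rewrite pf pg.
by apply: cvgD; [exact: cf|exact: cg].
Qed.

Lemma circle_funZ (k : R) f : circle_fun f -> circle_fun (fun x => k * f x).
Proof.
move=> [cf pf]; split => x; last by rewrite pf.
by apply: cvgMr; exact: cf.
Qed.

(** The free phase [c] lets one real family cover sines, cosines and the terms of translated Fejer
    kernels. *)
Lemma circle_fun_cos (n : int) (c : R) :
  circle_fun (fun x => cos (2 * pi * n%:~R * x + c)).
Proof.
split => x; last first.
  have -> : 2 * pi * n%:~R * (x + 1) + c = 2 * pi * n%:~R * x + c + 2 * pi * n%:~R by ring.
  exact: cosD2pin.
apply: continuous_comp; last exact: continuous_cos.
by apply: cvgD; [apply: cvgMr; exact: cvg_id|exact: cvg_cst].
Qed.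

(* The common features of the expectations [f |-> E f(S_M)] and of the Lebesgue
   integral over a period. *)
Definition circle_mean L :=
  [/\ forall f g, circle_fun f -> circle_fun g ->
        L (fun x => f x + g x) = L f + L g,
      forall k f, circle_fun f -> L (fun x => k * f x) = k * L f &
      forall e f, circle_fun f -> (forall x, `|f x| <= e) -> `|L f| <= e].

Lemma circle_mean_dist L f g e : circle_mean L -> circle_fun f -> circle_fun g ->
  (forall x, `|f x - g x| <= e) -> `|L f - L g| <= e.
Proof.
move=> [LD LZ Lle] cf cg fg.
have cNg := circle_funZ (-1) cg.
rewrite -mulN1r -LZ// -LD//; apply: Lle; first exact: circle_funD.
by move=> x; rewrite mulN1r.
Qed.

Variables (L_ : nat -> (R -> R) -> R) (L : (R -> R) -> R).
Hypotheses (mL_ : forall M, circle_mean (L_ M)) (mL : circle_mean L).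
(** [circle_fun f] is carried along because a [circle_mean] is linear only on such functions. *)
Let converges f := circle_fun f /\ L_ M f @[M --> \oo] --> L f.

Let convergesD f g :
  converges f -> converges g -> converges (fun x => f x + g x).
Proof.
move=> [cf Lf] [cg Lg]; split; first exact: circle_funD.
have D L' : circle_mean L' -> L' (fun x => f x + g x) = L' f + L' g.
  by move=> [LD _ _]; exact: LD.
by rewrite D//; under eq_fun do rewrite D//; exact: cvgD.
Qed.

Let convergesZ k f : converges f -> converges (fun x => k * f x).
Proof.
move=> [cf Lf]; split; first exact: circle_funZ.
have Z L' : circle_mean L' -> L' (fun x => k * f x) = k * L' f.
  by move=> [_ LZ _]; exact: LZ.
by rewrite Z//; under eq_fun do rewrite Z//; exact: cvgMr.
Qed.

Let converges0 : converges (fun=> 0).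
Proof.
have c0 : circle_fun (fun=> 0 : R) by split => // x; exact: cvg_cst.
split => //.
have mean0 L' : circle_mean L' -> L' (fun=> 0) = 0.
  move=> [_ _ /(_ 0 _ c0) H]; apply/eqP; rewrite -normr_le0; apply: H.
  by move=> _; rewrite normr0.
under eq_fun do rewrite mean0//.
by rewrite mean0//; exact: cvg_cst.
Qed.

Let converges_sum (I : Type) (s : seq I) (F : I -> R -> R) :
  (forall i, converges (F i)) -> converges (fun x => \sum_(i <- s) F i x).
Proof.
move=> cF; elim: s => [|i s ih].
  by under eq_fun do rewrite big_nil.
by under eq_fun do rewrite big_cons; exact: convergesD.
Qed.

(** A three-epsilon argument: replacing [f] by its Fejer approximant [T] moves every mean by at most
    [e / 3], uniformly in [M], and [T] is a linear combination of phase-shifted cosines. *)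
Lemma weyl_criterion :
  (forall (n : int) c, L_ M (fun x => cos (2 * pi * n%:~R * x + c)) @[M --> \oo]
     --> L (fun x => cos (2 * pi * n%:~R * x + c))) ->
  forall f, circle_fun f -> L_ M f @[M --> \oo] --> L f.
Proof.
move=> Lcos f cf; have [fc fp] := cf.
apply/cvgrPdist_le => e e0; have e30 : 0 < e / 3 by rewrite divr_gt0.
have [N N0 HN] := fejer_approx fc fp e30.
pose T x := \sum_(j < N) f (j%:R / N%:R) * fejer N (x - j%:R / N%:R).
have [cT LT] : converges T.
  apply: converges_sum => j; apply: convergesZ; apply: convergesZ.
  apply: converges_sum => k; apply: converges_sum => l.
  have -> : (fun x : R => cos (2 * pi * (k%:Z - l%:Z)%:~R * (x - j%:R / N%:R))) =
      fun x => cos (2 * pi * (k%:Z - l%:Z)%:~R * x +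
                    - (2 * pi * (k%:Z - l%:Z)%:~R * (j%:R / N%:R))).
    by apply/funext => x; congr cos; rewrite mulrBr.
  by split; [exact: circle_fun_cos|exact: Lcos].
have near_T L' : circle_mean L' -> `|L' f - L' T| <= e / 3.
  by move=> mL'; exact: circle_mean_dist.
move/cvgrPdist_le: LT => /(_ _ e30); apply: filterS => M LTM.
have -> : L f - L_ M f = (L f - L T) + (L T - L_ M T) - (L_ M f - L_ M T) by ring.
have := near_T _ mL; have := near_T _ (mL_ M); rewrite !ler_norml in LTM *.
move: LTM => /andP[? ?] /andP[? ?] /andP[? ?]; lra.
Qed.

End weyl_criterion.

(** * Integrals over a set of mass one as circle means *)

Section Rintegral_mean.
Context {R : realType} d (T : measurableType d) (mu : {measure set T -> \bar R}).
Variables (D : set T) (X : T -> R).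
Hypotheses (mD : measurable D) (muD : mu D = 1%E) (mX : measurable_fun D X).

Lemma circle_fun_integrable (f : R -> R) : circle_fun f ->
  mu.-integrable D (EFin \o (f \o X)).
Proof.
move=> [fc fp]; apply: measurable_bounded_integrable => //.
- by rewrite muD ltry.
- by apply: measurableT_comp mX; exact: continuous_measurable_fun.
have [B B0 HB] := periodic_bounded fc fp.
exists B; split; first exact: num_real.
by move=> x Bx t _ /=; rewrite (le_trans (HB _))// ltW.
Qed.

Lemma Rintegral_mean_cst (c : R) : \int[mu]_(t in D) c = c.
Proof. by rewrite Rintegral_cst// muD mulr1. Qed.

(** Used for [P] with [X] a partial sum, and for Lebesgue measure on [0, 1] with [X] the
    identity. *)
Lemma Rintegral_mean : circle_mean (fun f => \int[mu]_(t in D) f (X t)).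
Proof.
split=> [f g cf cg|k f cf|e f cf fe].
- by rewrite RintegralD//; exact: circle_fun_integrable.
- by rewrite RintegralZl//; exact: circle_fun_integrable.
have fi := circle_fun_integrable cf.
rewrite (le_trans (le_normr_Rintegral mD fi))//.
rewrite -[leRHS]Rintegral_mean_cst.
apply: le_Rintegral => //; first exact: integrable_norm.
apply: measurable_bounded_integrable => //; first by rewrite muD ltry.
  exact: bounded_cst.
by move=> t _; exact: fe.
Qed.

End Rintegral_mean.

(** * Convergence of complex values by components *)

Section complex_convergence.
Context {R : realType}.

Lemma norm_Re_le (z : R[i]) : (`|complex.Re z|%:C <= `|z|)%C.
Proof.
by rewrite normc_def lecR -sqrtr_sqr ler_wsqrtr// lerDl sqr_ge0.
Qed.

Lemma norm_Im_le (z : R[i]) : (`|complex.Im z|%:C <= `|z|)%C.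
Proof.
by rewrite normc_def lecR -sqrtr_sqr ler_wsqrtr// lerDr sqr_ge0.
Qed.

Lemma normc_le_ReIm (z : R[i]) :
  (`|z| <= (`|complex.Re z| + `|complex.Im z|)%:C)%C.
Proof.
rewrite normc_def lecR -[leRHS]ger0_norm ?addr_ge0// -sqrtr_sqr ler_wsqrtr//.
by rewrite sqrrD !real_normK ?num_real// lerD2r lerDl mulrn_wge0// mulr_ge0.
Qed.

Lemma cvg_complexP (T : Type) (F : set_system T) (FF : Filter F)
    (f : T -> R[i]^o) (l : R[i]^o) :
  f @ F --> l <->
  (complex.Re (f x) @[x --> F] --> complex.Re l) /\
  (complex.Im (f x) @[x --> F] --> complex.Im l).
Proof.
split=> [/cvgrPdist_lt fl|[/cvgrPdist_lt fr /cvgrPdist_lt fi]].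
  split; apply/cvgrPdist_lt => e e0.
    have : 0 < (e%:C)%C :> R[i]^o by rewrite ltcR.
    move=> /fl; apply: filterS => x; rewrite -raddfB /= => fx.
    by rewrite -ltcR (le_lt_trans (norm_Re_le _)).
  have : 0 < (e%:C)%C :> R[i]^o by rewrite ltcR.
  move=> /fl; apply: filterS => x; rewrite -raddfB /= => fx.
  by rewrite -ltcR (le_lt_trans (norm_Im_le _)).
(* The radius is itself an element of [R[i]]; being positive, it has zero imaginary part. *)
apply/cvgrPdist_lt => -[e e']; rewrite ltcE /= => /andP[/eqP-> e0].
have e20 : 0 < e / 2 by rewrite divr_gt0.
move: (fr _ e20) (fi _ e20); apply: filterS2 => x fxr fxi.
apply: le_lt_trans (normc_le_ReIm _) _.
rewrite ltcR !raddfB /=; lra.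
Qed.

End complex_convergence.

(** * Characters: integral over a period and multiplicativity *)

Lemma Rintegral_cos_period {R : realType} (n : int) (c : R) : n != 0 ->
  \int[@lebesgue_measure R]_(x in `[0, 1]) cos (2 * pi * n%:~R * x + c) = 0.
Proof.
move=> n0; set k := 2 * pi * n%:~R.
have k0 : k != 0 by rewrite !mulf_neq0 ?intr_eq0// gt_eqF ?pi_gt0.
(* An antiderivative with equal values at 0 and 1, since [k] is an integer multiple of [2 pi]. *)
pose G x := k^-1 * sin (k * x + c).
have dG (x : R) : is_derive x 1 G (cos (k * x + c)).
  have dl : is_derive x 1 (fun y : R => k * y + c) k.
    by apply: is_derive_eq; rewrite -[LHS]/(k *: 1 + 0) addr0 scaler1.
  have dsl := @is_derive1_comp _ sin _ x _ _ (is_derive_sin _) dl.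
  have := is_deriveZ k^-1 dsl; rewrite /G => dZ.
  by apply: (is_derive_eq dZ); rewrite /GRing.scale /= mulrCA mulVf ?mulr1.
have cG : continuous G.
  by move=> x; apply/differentiable_continuous/derivable1_diffP; exact: ex_derive.
rewrite /Rintegral (@continuous_FTC2 R _ G 0 1)//.
- by rewrite /G mulr1 mulr0 add0r [k + c]addrC /k sinD2pin subee.
- apply: continuous_subspaceT; exact: (circle_fun_cos n c).1.
- split; first by move=> x _; exact: ex_derive.
  + by apply: cvg_at_right_filter; exact: cG.
  + by apply: cvg_at_left_filter; exact: cG.
- by move=> x _; rewrite derive1E; exact: derive_val.
Qed.

Lemma expiD {R : realType} (x y : R) : expi (x + y) = expi x * expi y.
Proof.
by rewrite /expi cosD sinD; apply/eqP; rewrite eq_complex /= [sin x * _ + _]addrC !eqxx.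
Qed.

Lemma expi_sum {R : realType} (I : finType) (F : I -> R) :
  expi (\sum_i F i) = \prod_i expi (F i).
Proof.
elim/big_ind2: _ => [|x _ y _ <- <-|//]; last by rewrite expiD.
by rewrite /expi cos0 sin0.
Qed.

(** * Sums of independent variables with finitely many values *)

Section finite_independence.
Context {R : realType} d (Omega : measurableType d) (P : probability Omega R).

Lemma Rintegral_sum_indic (I : finType) (c : I -> R) (E : I -> set Omega) :
  (forall i, measurable (E i)) ->
  \int[P]_t (\sum_i c i * \1_(E i) t) = \sum_i c i * fine (P (E i)).
Proof.
move=> mE; rewrite /Rintegral.
have cE i : P.-integrable setT (fun t => (c i * \1_(E i) t)%:E).
  by under eq_fun do rewrite EFinM; apply: integrableZl => //; exact: integrable_indic.
under eq_integral do rewrite -sumEFin.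
rewrite integral_sum//.
have iE i : (\int[P]_t (c i * \1_(E i) t)%:E = (c i * fine (P (E i)))%:E)%E.
  under eq_integral do rewrite EFinM.
  rewrite integralZl//; last exact: integrable_indic.
  by rewrite integral_indic// setIT EFinM fineK// fin_num_measure.
by under eq_bigr do rewrite iE; rewrite sumEFin.
Qed.

Variables (Y : nat -> {RV P >-> R}) (I : finType) (a : I -> R).
Hypotheses (indY : mutually_independent Y) (a_inj : injective a).
Hypothesis Y_range : forall m, \forall t \ae P, exists i, Y m t = a i.

Let p m i := fine (P (Y m @^-1` [set a i])).

Let cylinder M (j : {ffun 'I_M -> I}) := [set t | forall m : 'I_M, Y m t = a (j m)].

(** [mutually_independent] takes families of sets indexed by all naturals, so [j] is extended by the
    default [setT] outside the first [M] indices. *)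
Let cylinderE M (j : {ffun 'I_M -> I}) :
  let B m := if insub m is Some i then [set a (j i)] else setT in
  cylinder j = \bigcap_(m in [set` [fset m in iota 0 M]%fset]) (Y m @^-1` B m).
Proof.
apply/seteqP; split => t /= tj.
  move=> m /=; rewrite !inE /= mem_iota add0n => mM.
  by rewrite insubT /= (tj (Ordinal _)).
move=> m; have /= := tj (val m); rewrite valK; apply.
by rewrite !inE /= mem_iota add0n /=.
Qed.

Let P_cylinder M (j : {ffun 'I_M -> I}) : P (cylinder j) = (\prod_(m < M) p m (j m))%:E.
Proof.
rewrite cylinderE indY; last by move=> m _; case: insub.
rewrite (perm_big (index_iota 0 M)) /=; last first.
  by apply: uniq_perm => [||m]; rewrite ?fset_uniq ?iota_uniq// !inE /index_iota subn0.
rewrite big_mkord -prodEFin; apply: eq_bigr => m _.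
by rewrite valK /p fineK// fin_num_measure//; exact: measurable_funPTI.
Qed.

(** Almost surely the outcome lies in exactly one cylinder, on which the sum is constant; so [f] of
    the sum is almost everywhere a simple function, and independence gives each cylinder its product
    weight. *)
Lemma Rintegral_indep_sum (f : R -> R) M : measurable_fun setT f ->
  \int[P]_t f (\sum_(m < M) Y m t) =
  \sum_(j : {ffun 'I_M -> I}) (\prod_(m < M) p m (j m)) * f (\sum_(m < M) a (j m)).
Proof.
move=> mf.
have mcylinder j : measurable (@cylinder M j).
  rewrite cylinderE; apply: fin_bigcap_measurable => [|m _]; first exact: finite_fset.
  by apply: measurable_funPTI; case: insub.
transitivity (\int[P]_t (\sum_(j : {ffun 'I_M -> I}) f (\sum_(m < M) a (j m)) * \1_(cylinder j) t)).
  congr fine; apply: ae_eq_integral => //.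
  - apply/measurable_EFinP; apply: measurableT_comp mf _; exact: measurable_sum.
  - apply/measurable_EFinP; apply: measurable_sum => j.
    by apply: measurable_funM => //; exact: measurable_indic.
  have : \forall t \ae P, forall m : 'I_M, exists i, Y m t = a i.
    by apply: filter_forall => m; exact: Y_range.
  apply: filterS => t Yt _ /=.
  pose j : {ffun 'I_M -> I} := [ffun m => sval (cid (Yt m))].
  have jP (m : 'I_M) : Y m t = a (j m) by rewrite ffunE; exact: svalP (cid (Yt m)).
  rewrite (bigD1 j)//= indicE mem_set// mulr1 [X in _ + X]big1 ?addr0 => [|i ij].
    congr (f _)%:E; apply: eq_bigr => m _; exact: jP.
  (* Two cylinders containing [t] have the same index, by injectivity of [a]. *)
  rewrite indicE memNset ?mulr0// => ti; move/eqP: ij; apply.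
  by apply/ffunP => m; apply: a_inj; rewrite -jP -ti.
rewrite Rintegral_sum_indic//; apply: eq_bigr => j _.
by rewrite P_cylinder mulrC.
Qed.

(** The product of sums expands over all choices [j] of one value per factor, and
    [Rintegral_indep_sum] for cosine and sine gives the same terms. *)
Lemma prod_char_indep M (th : R) :
  \prod_(m < M) (\sum_i ((p m i)%:C)%C * expi (th * a i)) =
  Cintegral P setT (fun t => expi (th * \sum_(m < M) Y m t)).
Proof.
rewrite /Cintegral /expi /=.
have mth : measurable_fun setT (fun x : R => th * x) by exact: measurable_funM.
rewrite (@Rintegral_indep_sum (fun x => cos (th * x))); last first.
  by apply: measurableT_comp mth; exact: continuous_measurable_fun (@continuous_cos R).
rewrite (@Rintegral_indep_sum (fun x => sin (th * x))); last first.
  by apply: measurableT_comp mth; exact: continuous_measurable_fun (@continuous_sin R).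
rewrite (bigA_distr_bigA (fun (m : 'I_M) i => ((p m i)%:C)%C * expi (th * a i))) /=.
have jE (j : {ffun 'I_M -> I}) :
    \prod_(m < M) (((p m (j m))%:C)%C * expi (th * a (j m))) =
    ((\prod_(m < M) p m (j m))%:C)%C * expi (th * \sum_(m < M) a (j m)).
  by rewrite big_split /= rmorph_prod mulr_sumr expi_sum.
under eq_bigr do rewrite jE.
apply/eqP; rewrite eq_complex !raddf_sum /=; apply/andP; split; apply/eqP;
  by apply: eq_bigr => j _; rewrite mul0r ?subr0 ?addr0.
Qed.

End finite_independence.

(** * Values and Fourier coefficients of a variable with atomic law *)

Section discrete_law.
Context {R : realType} d (Omega : measurableType d) (P : probability Omega R).
Variables (Y : {RV P >-> R}) (r : nat) (w : 'I_r -> {posnum R}) (alpha : 'I_r -> R).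
Hypothesis law : forall B : set R, measurable B ->
  distribution P Y B = atomic w alpha B.
Variables (I : finType) (a : I -> R).
Hypotheses (a_inj : injective a) (alphaP : forall k, exists i, alpha k = a i).

Lemma atomic_ae_range : \forall t \ae P, exists i, Y t = a i.
Proof.
have mC : measurable (~` range a).
  apply: measurableC; apply: countable_measurable => //.
  by apply: finite_set_countable; apply: finite_image; exact: finite_finset.
exists (Y @^-1` (~` range a)); split.
- exact: measurable_funPTI.
- transitivity (distribution P Y (~` range a)); first by [].
  rewrite law// /atomic big1// => k _.
  rewrite diracE memNset ?mule0//=; apply; have [i ->] := alphaP k.
  by exists i.
- by move=> t /= nYt [i _ Yi]; apply: nYt; exists i.
Qed.

Lemma fine_atomic_set1 (x : R) :
  fine (P (Y @^-1` [set x])) = \sum_(k < r) (if alpha k == x then (w k)%:num else 0).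
Proof.
rewrite -[P _]/(distribution P Y [set x]) law// /atomic -[RHS]/(fine (_)%:E) -sumEFin.
congr fine; apply: eq_bigr => k _; rewrite diracE.
by case: eqP => akx; [rewrite mem_set// mule1|rewrite memNset// mule0].
Qed.

(** Atoms are regrouped by value: the points [alpha k] may repeat, but each equals [a i] for exactly
    one [i]. The index type [I] can then be shared by all variables, as [prod_char_indep]
    requires. *)
Lemma fourier_coef_law (n : int) : (forall k, alpha k \in `[0, 1[) ->
  fourier_coef (atomic w alpha) n =
  \sum_i ((fine (P (Y @^-1` [set a i])))%:C)%C * expi (- (2 * pi * n%:~R) * a i).
Proof.
move=> a01; rewrite fourier_coef_atomic//.
under [RHS]eq_bigr => i _ do rewrite fine_atomic_set1 rmorph_sum mulr_suml.
rewrite exchange_big /=; apply: eq_bigr => k _.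
have [i ki] := alphaP k; rewrite (bigD1 i)//= ki eqxx [X in _ + X]big1 ?addr0 ?mulNr//.
by move=> j ji; rewrite (inj_eq a_inj) eq_sym (negbTE ji) rmorph0 mul0r.
Qed.

End discrete_law.

(** * Test functions on the circle and the equivalence *)

Lemma frac_part_periodic {R : realType} (V : zmodType) (f : R -> V) (x : R) :
  periodic f 1 -> f (frac_part x) = f x.
Proof.
by move=> fp; rewrite /frac_part -(periodic1_int x (- Num.floor x) fp) rmorphN.
Qed.

(** Sine is cosine with phase [- pi / 2], so both components are instances of
    [Rintegral_cos_period]. *)
Lemma Cintegral_expi {R : realType} (n : int) : n != 0 ->
  Cintegral (@lebesgue_measure R) `[0, 1] (fun x => expi (- (2 * pi * n%:~R) * x)) = 0.
Proof.
move=> n0; have n0' : - n != 0 by rewrite oppr_eq0.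
rewrite /Cintegral /expi /=.
have argE (x : R) : - (2 * pi * n%:~R) * x = 2 * pi * (- n)%:~R * x.
  by rewrite rmorphN /=; ring.
apply/eqP; rewrite eq_complex /=; apply/andP; split; apply/eqP.
  rewrite -[RHS](Rintegral_cos_period 0 n0'); apply: eq_Rintegral => x _.
  by rewrite argE addr0.
rewrite -[RHS](Rintegral_cos_period (- (pi / 2)) n0'); apply: eq_Rintegral => x _.
by rewrite argE cosBpihalf.
Qed.

Lemma circle_fun_expi {R : realType} (n : int) :
  circle_fun (fun x : R => cos (- (2 * pi * n%:~R) * x)) /\
  circle_fun (fun x : R => sin (- (2 * pi * n%:~R) * x)).
Proof.
split.
  have -> : (fun x : R => cos (- (2 * pi * n%:~R) * x)) =
      fun x => cos (2 * pi * (- n)%:~R * x + 0).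
    by apply/funext => x; rewrite rmorphN; congr cos => /=; ring.
  exact: circle_fun_cos.
have -> : (fun x : R => sin (- (2 * pi * n%:~R) * x)) =
    fun x => cos (2 * pi * (- n)%:~R * x + - (pi / 2)).
  by apply/funext => x; rewrite cosBpihalf rmorphN; congr sin => /=; ring.
exact: circle_fun_cos.
Qed.

Lemma continuous_ReIm {R : realType} (phi : R -> R[i]^o) :
  continuous phi <->
  continuous (fun x => complex.Re (phi x)) /\ continuous (fun x => complex.Im (phi x)).
Proof.
split=> [c|[cr ci] x]; last first.
  by apply/cvg_complexP; split; [exact: cr|exact: ci].
by split=> x; have /cvg_complexP[] := c x.
Qed.

Lemma circle_fun_ReIm {R : realType} (phi : R -> R[i]^o) :
  continuous phi /\ periodic phi 1 <->
  circle_fun (fun x => complex.Re (phi x)) /\ circle_fun (fun x => complex.Im (phi x)).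
Proof.
split=> [[/continuous_ReIm[cr ci] pphi]|[[cr pr] [ci p_i]]].
  by split; split=> // x; rewrite pphi.
split; first exact/continuous_ReIm.
by move=> x; apply/eqP; rewrite eq_complex pr p_i !eqxx.
Qed.

Theorem theorem1p3 (R : realType) (d : measure_display)
    (Omega : measurableType d) (P : probability Omega R)
    (Y : nat -> {RV P >-> R}) (r : nat -> nat)
    (w : forall m : nat, 'I_(r m) -> {posnum R})
    (alpha : forall m : nat, 'I_(r m) -> R) (A : set R) :
  mutually_independent Y ->
  (forall m : nat, \sum_(k < r m) (w m k)%:num = 1) ->
  (forall (m : nat) (B : set R), measurable B ->
     distribution P (Y m) B = atomic (w m) (alpha m) B) ->
  finite_set A -> A `<=` `[0, 1[ ->
  (forall (m : nat) (k : 'I_(r m)), A (alpha m k)) ->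
  cvg_weakly_to_uniform P
    (fun (M : nat) (t : Omega) => frac_part (\sum_(m < M) Y m t)) <->
  (forall n : int, n != 0 ->
     (fun M : nat =>
        (\prod_(m < M) fourier_coef (atomic (w m) (alpha m)) n : R[i]^o))
       @ \oo --> (0 : R[i]^o)).
Proof.
move=> indY w1 law finA A01 alphaA.
(* The distinct points of [A] give one finite index type for all the variables; this is how
   finiteness of [A] enters. *)
have [s As] := (finite_seqP A).1 finA.
pose a (x : seq_sub s) : R := ssval x.
have a_inj : injective a := val_inj.
have alpha_a m k : exists i, alpha m k = a i.
  have ams : alpha m k \in s by have := alphaA m k; rewrite As.
  by exists (SeqSub ams).
have Y_range m := atomic_ae_range (law m) (alpha_a m).
pose S M t := \sum_(m < M) Y m t.
have mS M : measurable_fun setT (S M) by exact: measurable_sum.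
pose L_ M (f : R -> R) := \int[P]_t f (S M t).
pose L (f : R -> R) := \int[@lebesgue_measure R]_(x in `[0, 1]) f x.
have mL_ M : circle_mean (L_ M).
  by apply: Rintegral_mean => //; exact: probability_setT.
have mu01 : @lebesgue_measure R `[0, 1] = 1%E.
  by rewrite lebesgue_measure_itv /= lte01 oppr0 adde0.
have mL : circle_mean L.
  exact: (@Rintegral_mean R _ _ (@lebesgue_measure R) _ (fun x => x) (measurable_itv _) mu01).
pose char n x : R[i]^o := expi (- (2 * pi * n%:~R) * x).
have prodE n M : \prod_(m < M) fourier_coef (atomic (w m) (alpha m)) n =
    Cintegral P setT (fun t => char n (S M t)).
  rewrite /char -(prod_char_indep indY a_inj Y_range); apply: eq_bigr => m _.
  by rewrite -(fourier_coef_law (law m) a_inj (alpha_a m))// => k; apply/A01.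
have char_circle n : continuous (char n) /\ periodic (char n) 1.
  by apply/circle_fun_ReIm; exact: circle_fun_expi.
(* Periodic test functions do not see reduction modulo 1. *)
have fracE phi M : periodic phi 1 ->
    Cintegral P setT (phi \o (fun t => frac_part (\sum_(m < M) Y m t))) =
    Cintegral P setT (fun t => phi (S M t)).
  by move=> pphi; congr Complex; apply: eq_Rintegral => t _ /=; rewrite frac_part_periodic.
(* Forward: characters are admissible test functions, with integral 0 over a period when [n] is
   nonzero. *)
split=> [unif n n0|Lchar phi cphi pphi].
  have [cc pc] := char_circle n.
  under eq_fun do rewrite prodE -fracE//.
  rewrite -(Cintegral_expi n0); exact: unif.
have [cr ci] := (circle_fun_ReIm phi).1 (conj cphi pphi).
under eq_fun do rewrite fracE//.
(* A cosine with phase is a real combination of the two components of a character; the hypothesis is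
   silent at [n = 0], where the function is constant and all means agree. *)
have Lcos n c : L_ M (fun x => cos (2 * pi * n%:~R * x + c)) @[M --> \oo]
     --> L (fun x => cos (2 * pi * n%:~R * x + c)).
  have [->|n0] := eqVneq n 0.
    have -> : (fun x : R => cos (2 * pi * 0%:~R * x + c)) = fun=> cos c.
      by apply/funext => x; rewrite mulr0 mul0r add0r.
    have L_1 M : L_ M (fun=> cos c) = cos c.
      by apply: Rintegral_mean_cst => //; exact: probability_setT.
    have L1 : L (fun=> cos c) = cos c.
      exact: (@Rintegral_mean_cst R _ _ (@lebesgue_measure R) _ (measurable_itv _) mu01).
    by under eq_fun do rewrite L_1; rewrite L1; exact: cvg_cst.
  have [cc cs] := @circle_fun_expi R n.
  have -> : (fun x : R => cos (2 * pi * n%:~R * x + c)) =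
      fun x => cos c * cos (- (2 * pi * n%:~R) * x) + sin c * sin (- (2 * pi * n%:~R) * x).
    apply/funext => x; have -> : 2 * pi * n%:~R * x + c = c - (- (2 * pi * n%:~R) * x) by ring.
    by rewrite cosB.
  have mE L' : circle_mean L' -> L' (fun x => cos c * cos (- (2 * pi * n%:~R) * x) +
        sin c * sin (- (2 * pi * n%:~R) * x)) =
      cos c * L' (fun x => cos (- (2 * pi * n%:~R) * x)) +
      sin c * L' (fun x => sin (- (2 * pi * n%:~R) * x)).
    by move=> [LD LZ _]; rewrite LD ?LZ//; exact: circle_funZ.
  rewrite mE//; under eq_fun do rewrite mE//.
  have /eqP := @Cintegral_expi R n n0.
  rewrite eq_complex /= => /andP[/eqP Lc0 /eqP Ls0]; rewrite /L Lc0 Ls0.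
  have := Lchar n n0; under eq_fun do rewrite prodE.
  by move=> /cvg_complexP[lc ls]; apply: cvgD; apply: cvgMr.
by apply/cvg_complexP; split; exact: (weyl_criterion mL_ mL Lcos).
Qed.
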